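(* For $\lambda\in(0,\infty)$, let $\Delta_\phi$ be the friendship bias of the root of the Galton-Watson tree with Poisson($\lambda$) offspring distribution. Then for every $\lambda\in(0,\infty)$, $$\mathbb E[\Delta_\phi]=1-(\lambda+1)e^{-\lambda},$$ $$\mathbb E[\Delta_\phi^2]=\lambda\Big(\sum_{k=1}^\infty k^{-1}\frac{e^{-\lambda}\lambda^k}{k!}+1\Big)-(\lambda+1)^2e^{-\lambda}+1.$$ In particular, $\lim_{\lambda\downarrow0}\mathbb E[\Delta_\phi]=0$, $\lim_{\lambda\downarrow0}\mathbb E[\Delta_\phi^2]=0$, $\lim_{\lambda\to\infty}\mathbb E[\Delta_\phi]=1$ and $\lim_{\lambda\to\infty}\mathbb E[\Delta_\phi^2]=\infty$.
   Context: Let $d_\phi$ be the number of children of the root $\phi$ and $d_j$ the number of children of the $j$-th child of the root; here $d_\phi,d_1,d_2,\ldots$ are i.i.d. Poisson($\lambda$) random variables. The friendship bias of the root is $$\Delta_\phi=\Big[\frac1{d_\phi}\sum_{j=1}^{d_\phi}(d_j+1)-d_\phi\Big]\mathbb 1_{\{d_\phi\ne0\}}$$ (so $\Delta_\phi=0$ when $d_\phi=0$). This tree is the local limit of the homogeneous Erdős-Rényi random graph with edge probability $\frac\lambda n\wedge1$. *)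

(* Defs.v *)
From HB Require Import structures.
From mathcomp Require Import all_boot all_order all_algebra.
From mathcomp Require Import finmap.
From mathcomp Require Import all_classical all_reals all_analysis.

Set Implicit Arguments.
Unset Strict Implicit.
Unset Printing Implicit Defensive.

Import Order.TTheory GRing.Theory Num.Theory.
Import numFieldNormedType.Exports.

Local Open Scope classical_set_scope.
Local Open Scope ring_scope.

(* Rooted ordered trees in Ulam-Harris coding: a vertex is the word of the
   (0-based) birth ranks on the path from the root [::], and a tree is the set
   of its vertices. *)

Definition children (t : set (seq nat)) (u : seq nat) : set nat :=
  [set j | t (rcons u j)].

(* fset_set sends infinite sets to the empty fset, so this is 0 at a vertex
   with infinitely many children; gw_tree below has no such vertex. *)
Definition nchildren (t : set (seq nat)) (u : seq nat) : nat :=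
  #|` fset_set (children t u)|%fset.

(* A vertex belongs to the tree with offspring numbers z when each of its
   letters is less than the offspring number of the preceding ancestor. *)
Definition gw_tree (z : seq nat -> nat) : set (seq nat) :=
  [set u | forall k, (k < size u)%N -> (nth 0%N u k < z (take k u))%N].

(* The children of the root are numbered 0, ..., d - 1, and the j-th of them is
   the word [:: j], whose degree is its number of children plus one for the
   edge to the root. *)
Definition root_bias (R : realType) (t : set (seq nat)) : R :=
  let d := nchildren t [::] in
  if d == 0%N then 0
  else d%:R^-1 * (\sum_(j < d) ((nchildren t [:: nat_of_ord j])%:R + 1)) - d%:R.

Definition mutually_independent (d d' : measure_display)
    (T : measurableType d) (T' : measurableType d') (R : realType)
    (P : probability T R) (I : choiceType) (X : I -> {RV P >-> T'}) : Prop :=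
  forall (J : {fset I}) (A : I -> set T'), (forall i, measurable (A i)) ->
    P (\bigcap_(i in [set` J]) (X i @^-1` A i)) =
    (\prod_(i <- J) P (X i @^-1` A i))%E.

(* Offspring numbers of the Galton-Watson tree with Poisson(lam) offspring:
   an i.i.d. family indexed by all words. *)
Definition poisson_offspring (d : measure_display) (T : measurableType d)
    (R : realType) (P : probability T R) (lam : R)
    (Z : seq nat -> {RV P >-> nat}) : Prop :=
  mutually_independent Z /\
  forall (u : seq nat) (k : nat),
    P (Z u @^-1` [set k]) = (poisson_pmf lam k)%:E.

(* The friendship bias of the root as a function of the sample point. *)
Definition Delta (d : measure_display) (T : measurableType d) (R : realType)
    (P : probability T R) (Z : seq nat -> {RV P >-> nat}) (w : T) : R :=
  root_bias R (gw_tree (fun u => Z u w)).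

Lemma gw_tree_rcons (z : seq nat -> nat) (u : seq nat) (j : nat) :
  gw_tree z (rcons u j) <-> gw_tree z u /\ (j < z u)%N.
Proof.
split=> [h|[hu hj] k].
  split=> [k ku|].
    have := h k; rewrite size_rcons ltnS (ltnW ku) nth_rcons ku => /(_ isT).
    by rewrite -cats1 takel_cat // ltnW.
  have := h (size u); rewrite size_rcons ltnSn nth_rcons ltnn eqxx => /(_ isT).
  by rewrite -cats1 take_size_cat.
rewrite size_rcons ltnS leq_eqVlt nth_rcons -cats1 => /orP[/eqP->|ku].
  by rewrite ltnn eqxx take_size_cat.
by rewrite ku takel_cat ?(ltnW ku) //; exact: hu.
Qed.

Lemma nchildren_gw_tree (z : seq nat -> nat) (u : seq nat) :
  gw_tree z u -> nchildren (gw_tree z) u = z u.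
Proof.
move=> hu; rewrite /nchildren.
have -> : children (gw_tree z) u = `I_(z u).
  by apply/seteqP; split=> j /=; rewrite /children /= gw_tree_rcons; [case|].
by apply: card_fset_set; exact: card_eqxx.
Qed.

Lemma root_bias_gw_tree (R : realType) (z : seq nat -> nat) :
  root_bias R (gw_tree z) =
  ((z [::])%:R^-1 * (\sum_(j < z [::]) ((z [:: nat_of_ord j])%:R + 1))
   - (z [::])%:R) * (z [::] != 0%N)%:R.
Proof.
have h0 : gw_tree z [::] by [].
rewrite /root_bias (nchildren_gw_tree h0).
case: eqP => [|_] /=; first by rewrite mulr0.
rewrite mulr1; congr (_ * _ - _); apply: eq_bigr => j _.
by rewrite nchildren_gw_tree //; apply/(gw_tree_rcons z [::]).
Qed.

(* Main.v *)
(* Condition on the number k of children of the root. On {d = k} with k >= 1 the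
   bias is M + 1 - k, where M is the mean of k independent Poisson(lam) variables,
   so its conditional mean is lam + 1 - k and its conditional second moment is
   lam / k + (lam + 1 - k)^2. Summing against the Poisson weights, with the k = 0
   term of the full Poisson moments removed, gives both formulas. The limits
   follow from 1 - lam <= exp(-lam), from (lam + 1)^2 exp(-lam) <= 4, and from the
   sum of p_k / k over k >= 1 lying in [0, 1]. *)

Require Import Defs.
From HB Require Import structures.
From mathcomp Require Import all_boot all_order all_algebra.
From mathcomp Require Import finmap.
From mathcomp Require Import all_classical all_reals all_analysis.
From mathcomp Require Import measurable_realfun ring lra.

Import Order.TTheory GRing.Theory Num.Theory.
Import numFieldNormedType.Exports.

Set Implicit Arguments.
Unset Strict Implicit.
Unset Printing Implicit Defensive.

Local Open Scope classical_set_scope.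
Local Open Scope ring_scope.

(** * Moments of the Poisson law, as series in the extended reals *)

Lemma poisson_pmfE (R : realType) (lam : R) (k : nat) : 0 < lam ->
  poisson_pmf lam k = expR (- lam) * lam ^+ k / k`!%:R.
Proof. by move=> lam0; rewrite /poisson_pmf lam0 mulrC mulrA. Qed.

Lemma poisson_pmfS (R : realType) (lam : R) (k : nat) : 0 < lam ->
  k.+1%:R * poisson_pmf lam k.+1 = lam * poisson_pmf lam k.
Proof.
move=> lam0; rewrite !poisson_pmfE// factS natrM exprS.
have k0 : k.+1%:R != 0 :> R by rewrite pnatr_eq0.
have f0 : k`!%:R != 0 :> R by rewrite pnatr_eq0 -lt0n fact_gt0.
rewrite invfM; move: (k.+1%:R) k0 (k`!%:R) f0 (expR _) => a a0 b b0 e.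
by field; rewrite b0.
Qed.

Lemma poisson_sum (R : realType) (lam : R) : 0 < lam ->
  (\sum_(k <oo) (poisson_pmf lam k)%:E = 1)%E.
Proof.
move=> lam0; have : poisson_prob lam 0%N setT = 1%E by exact: probability_setT.
by rewrite /poisson_prob lam0 -nneseries_esumT => [->|k]; rewrite ?lee_fin ?poisson_pmf_ge0.
Qed.

(* The Stein-Chen identity E[X h(X)] = lam E[h(X + 1)]. *)
Lemma poisson_stein_chen (R : realType) (lam : R) (h : nat -> R) : 0 < lam ->
  (forall k, 0 <= h k) ->
  (\sum_(k <oo) (k%:R * h k * poisson_pmf lam k)%:E =
   lam%:E * \sum_(k <oo) (h k.+1 * poisson_pmf lam k)%:E)%E.
Proof.
move=> lam0 h0; have pmf0 := @poisson_pmf_ge0 R lam.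
(* The term of index 0 vanishes through its factor [k]; after the shift, [poisson_pmfS] trades
   [k + 1] for [lam]. *)
rewrite nneseries_recl//; last by move=> k _; rewrite lee_fin !mulr_ge0.
rewrite !mul0r add0e -nneseries_addn; last first.
  by move=> k; rewrite lee_fin !mulr_ge0.
rewrite -nneseriesZl; last by move=> k _; rewrite lee_fin mulr_ge0.
apply: eq_eseriesr => k _; rewrite addn1 -EFinM; congr EFin.
by rewrite mulrAC (poisson_pmfS k lam0) -mulrA [_ * h _]mulrC.
Qed.

Lemma poisson_moment1 (R : realType) (lam : R) : 0 < lam ->
  (\sum_(k <oo) (k%:R * poisson_pmf lam k)%:E = lam%:E)%E.
Proof.
move=> lam0; have := poisson_stein_chen lam0 (fun _ => ler01).
under eq_eseriesr do rewrite mulr1.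
by under [in RHS]eq_eseriesr do rewrite mul1r; rewrite poisson_sum// mule1.
Qed.

(** Stein-Chen with [h k = k] gives [lam] times the mean of [X + 1]. *)
Lemma poisson_moment2 (R : realType) (lam : R) : 0 < lam ->
  (\sum_(k <oo) (k%:R ^+ 2 * poisson_pmf lam k)%:E = (lam * (lam + 1))%:E)%E.
Proof.
move=> lam0; have pmf0 := @poisson_pmf_ge0 R lam.
under eq_eseriesr do rewrite expr2.
rewrite (poisson_stein_chen lam0) => [|k]; last exact: ler0n.
under eq_eseriesr do rewrite -natr1 mulrDl mul1r EFinD.
rewrite nneseriesD => [|k _ _|k _ _]; rewrite ?lee_fin ?mulr_ge0//.
by rewrite poisson_moment1// poisson_sum// -EFinD -EFinM.
Qed.

(** This is the variance [lam] plus the squared distance 1 between [lam + 1] and the mean. Without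
    its term of index 0, it is the contribution of the conditional means to the second moment of
    [Delta]. *)
Lemma poisson_shifted_moment2 (R : realType) (lam : R) : 0 < lam ->
  (\sum_(k <oo) ((lam + 1 - k%:R) ^+ 2 * poisson_pmf lam k)%:E = (lam + 1)%:E)%E.
Proof.
move=> lam0; have pmf0 := @poisson_pmf_ge0 R lam.
have lam10 : 0 <= lam + 1 by lra.
(* The cross term of the square stands on the left, so that all series have nonnegative terms and
   add freely. *)
have : (\sum_(k <oo) ((lam + 1 - k%:R) ^+ 2 * poisson_pmf lam k)%:E +
    (2 * (lam + 1))%:E * \sum_(k <oo) (k%:R * poisson_pmf lam k)%:E =
  ((lam + 1) ^+ 2)%:E * \sum_(k <oo) (poisson_pmf lam k)%:E +
    \sum_(k <oo) (k%:R ^+ 2 * poisson_pmf lam k)%:E)%E.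
  rewrite -!nneseriesZl => [|k _|k _]; rewrite ?lee_fin ?mulr_ge0//.
  rewrite -!nneseriesD => [|k _ _|k _ _|k _ _|k _ _]; last 4 first.
  - by rewrite -EFinM lee_fin mulr_ge0 ?sqr_ge0.
  - by rewrite lee_fin mulr_ge0 ?sqr_ge0.
  - by rewrite lee_fin mulr_ge0 ?sqr_ge0.
  - by rewrite -EFinM lee_fin !mulr_ge0.
  by apply: eq_eseriesr => k _; rewrite -!EFinM -!EFinD; congr EFin; ring.
rewrite poisson_moment1// poisson_moment2// poisson_sum// mule1 -EFinM -EFinD.
move=> /eqP; rewrite eq_sym -sube_eq ?fin_num_adde_defl// => /eqP <-.
by rewrite -EFinB; congr EFin; ring.
Qed.

(** * Decomposition over the values of a random natural number *)

Lemma preimage_set1_cover (T : Type) (X : T -> nat) :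
  \bigcup_k (X @^-1` [set k]) = setT.
Proof. by apply/seteqP; split => // w _; exists (X w). Qed.

Lemma ge0_integral_fibers (d : measure_display) (T : measurableType d)
    (R : realType) (P : probability T R) (X : {RV P >-> nat}) (D : set T)
    (f : T -> \bar R) : measurable D -> measurable_fun D f ->
  (forall w, D w -> 0 <= f w)%E ->
  (\int[P]_(w in D) f w =
   \sum_(k <oo) \int[P]_(w in D `&` X @^-1` [set k]) f w)%E.
Proof.
move=> mD mf f0.
have DE : \bigcup_k (D `&` X @^-1` [set k]) = D.
  by rewrite -setI_bigcupr preimage_set1_cover setIT.
rewrite -[in LHS]DE ge0_integral_bigcup ?DE//.
  by move=> k; apply: measurableI => //; exact: measurable_funPTI.
apply: trivIset_setIl; apply/trivIsetP => i j _ _ ij.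
by rewrite -preimage_setI -subset0 => w [-> ji]; rewrite ji eqxx in ij.
Qed.

(** Serves for [Delta], whose number of summands is random but constant on each fibre of the root
    degree. *)
Lemma measurable_fun_fibers (d d' : measure_display) (T : measurableType d)
    (T' : measurableType d') (R : realType) (P : probability T R)
    (X : {RV P >-> nat}) (f : T -> T') :
  (forall k, measurable_fun (X @^-1` [set k]) f) -> measurable_fun setT f.
Proof.
move=> mf; rewrite -(preimage_set1_cover X).
by apply/measurable_fun_bigcup => // k; exact: measurable_funPTI.
Qed.

Lemma measurable_comp_nat (d d' : measure_display) (T : measurableType d)
    (T' : measurableType d') (R : realType) (P : probability T R)
    (X : {RV P >-> nat}) (g : nat -> T') (D : set T) :
  measurable D -> measurable_fun D (fun w => g (X w)).
Proof.
by move=> mD; apply: (@measurable_funS _ _ _ _ setT) => //; exact: measurableT_comp.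
Qed.

(** * Product moments of the independent offspring numbers *)

Lemma poisson_offspring_joint (d : measure_display) (T : measurableType d)
    (R : realType) (P : probability T R) (lam : R)
    (Z : seq nat -> {RV P >-> nat}) (s : seq (seq nat)) (x : seq nat -> nat) :
  poisson_offspring lam Z -> uniq s ->
  (P (\bigcap_(i in [set` s]) (Z i @^-1` [set x i])) =
   (\prod_(i <- s) poisson_pmf lam (x i))%:E)%E.
Proof.
move=> [indep pmfZ] us.
have -> : [set` s] = [set` [fset i in s]%fset].
  by apply/seteqP; split => i /=; rewrite inE.
rewrite (indep [fset i in s]%fset (fun i => [set x i])) => [|//].
rewrite -prodEFin (perm_big s)/=; first by apply: eq_bigr => i _; rewrite pmfZ.
by apply: uniq_perm => [|//|i]; rewrite ?fset_uniq ?inE.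
Qed.

(* Induction on s: splitting on the value of Z v moves v from the factors s to
   the pinned indices r. *)
Lemma poisson_offspring_moment (d : measure_display) (T : measurableType d)
    (R : realType) (P : probability T R) (lam : R)
    (Z : seq nat -> {RV P >-> nat}) (g : seq nat -> nat -> R)
    (m : seq nat -> R) (s r : seq (seq nat)) (x : seq nat -> nat) :
  poisson_offspring lam Z -> (forall i k, 0 <= g i k) ->
  (forall i, \sum_(k <oo) (g i k * poisson_pmf lam k)%:E = (m i)%:E)%E ->
  uniq (s ++ r) ->
  (\int[P]_(w in \bigcap_(i in [set` r]) (Z i @^-1` [set x i]))
      (\prod_(i <- s) g i (Z i w))%:E =
   (\prod_(i <- r) poisson_pmf lam (x i) * \prod_(i <- s) m i)%:E)%E.
Proof.
move=> PZ g0 mE.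
have mD (s' : seq (seq nat)) (y : seq nat -> nat) :
    measurable (\bigcap_(i in [set` s']) (Z i @^-1` [set y i])).
  by apply: fin_bigcap_measurable => // i _; exact: measurable_funPTI.
elim: s r x => [|v s IHs] r x.
  move=> /= ur; under eq_integral do rewrite big_nil.
  rewrite integral_cst// mul1e big_nil mulr1.
  exact: poisson_offspring_joint x PZ _.
rewrite cat_cons cons_uniq => /andP[vsr usr].
have mprod (s' : seq (seq nat)) D : measurable D ->
    measurable_fun D (fun w => \prod_(i <- s') g i (Z i w)).
  by move=> mD'; apply: measurable_prod => i _; exact: measurable_comp_nat.
rewrite (ge0_integral_fibers (Z v))//; last 2 first.
- by apply/measurable_EFinP; exact: mprod.
- by move=> w _; rewrite lee_fin prodr_ge0.
(* On the fibre where [Z v] is [k], the factor at [v] is the constant [g v k] and pinning [v]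
   contributes [poisson_pmf lam k]; the sum over [k] is [m v]. *)
transitivity (\sum_(k <oo) ((\prod_(i <- r) poisson_pmf lam (x i) *
    \prod_(i <- s) m i)%:E * (g v k * poisson_pmf lam k)%:E))%E; last first.
  rewrite nneseriesZl => [|k _]; last first.
    by rewrite lee_fin mulr_ge0// poisson_pmf_ge0.
  by rewrite mE -EFinM big_cons; congr EFin; ring.
apply: eq_eseriesr => k _.
(* [y] extends the pinned values by [k] at [v]; it agrees with [x] on [r] because uniqueness keeps
   [v] out of [r]. *)
pose y i := if i == v then k else x i.
have yr i : i \in r -> y i = x i.
  move=> ir; rewrite /y; case: eqP => // iv; move: vsr.
  by rewrite -iv mem_cat ir orbT.
have -> : \bigcap_(i in [set` r]) (Z i @^-1` [set x i]) `&` Z v @^-1` [set k] =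
    \bigcap_(i in [set` v :: r]) (Z i @^-1` [set y i]).
  apply/seteqP; split => w.
    move=> [wr wv] i /=; rewrite inE => /predU1P[->|ir]; first by rewrite /y eqxx.
    by rewrite yr//; exact: wr.
  move=> wr; split; last by have := wr v; rewrite /= /y eqxx mem_head; apply.
  by move=> i ir; have := wr i; rewrite /= yr// inE ir orbT; apply.
have Zv w : w \in \bigcap_(i in [set` v :: r]) (Z i @^-1` [set y i]) -> Z v w = k.
  by rewrite inE => /(_ v); rewrite /= /y eqxx mem_head; apply.
under eq_integral => w wD do rewrite big_cons (Zv _ wD) EFinM.
rewrite ge0_integralZl_EFin//; last 2 first.
- by move=> w _; rewrite lee_fin prodr_ge0.
- by apply/measurable_EFinP; exact: mprod.
rewrite IHs; last first.
  by rewrite (perm_uniq (s2 := v :: s ++ r)) ?perm_catCA ?cons_uniq ?vsr ?usr // -cat1s perm_catCA.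
rewrite big_cons {1}/y eqxx -EFinM; congr EFin.
rewrite (eq_big_seq (fun i => poisson_pmf lam (x i))); last by move=> i /yr ->.
ring.
Qed.

(** Only the root is pinned; the distinct vertices in [s] differ from it, so their variables stay
    i.i.d. on the event. The integral is not normalised, whence the factor [poisson_pmf lam k]. *)
Lemma poisson_offspring_root_moment (d : measure_display) (T : measurableType d)
    (R : realType) (P : probability T R) (lam : R)
    (Z : seq nat -> {RV P >-> nat}) (g : nat -> R) (m : R)
    (s : seq (seq nat)) (k : nat) :
  poisson_offspring lam Z -> (forall n, 0 <= g n) ->
  (\sum_(n <oo) (g n * poisson_pmf lam n)%:E = m%:E)%E ->
  uniq ([::] :: s) ->
  (\int[P]_(w in Z [::] @^-1` [set k]) (\prod_(i <- s) g (Z i w))%:E =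
   (poisson_pmf lam k * m ^+ size s)%:E)%E.
Proof.
move=> PZ g0 mE us.
have -> : Z [::] @^-1` [set k] =
    \bigcap_(i in [set` [:: [::] : seq nat]]) (Z i @^-1` [set k]).
  apply/seteqP; split=> [w Dw i|w]; first by rewrite /= inE => /eqP ->.
  by apply; rewrite /= mem_head.
have us0 : uniq (s ++ [:: [::]]) by rewrite cats1 -rot1_cons rot_uniq.
apply: etrans (poisson_offspring_moment (fun=> k) PZ (fun=> g0) (fun=> mE) us0) _.
by rewrite big_seq1 big_const_seq count_predT iter_mulr_1.
Qed.

(** * Conditional moments of the mean offspring number of the root's children *)

(** The count [k] is a parameter rather than [z [::]], so that the sum has a deterministic
    length. *)
Definition children_mean (R : realType) (z : seq nat -> nat) (k : nat) : R :=
  k%:R^-1 * \sum_(j < k) (z [:: nat_of_ord j])%:R.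

(** The edges to the root add 1 to the mean, which cancels one unit of the degree [k.+1]. *)
Lemma root_bias_children_mean (R : realType) (z : seq nat -> nat) (k : nat) :
  z [::] = k.+1 -> root_bias R (gw_tree z) = children_mean R z k.+1 - k%:R.
Proof.
move=> zk; rewrite root_bias_gw_tree zk/= mulr1 big_split/= mulrDr.
rewrite sumr_const card_ord mulVf ?pnatr_eq0// /children_mean -natr1; ring.
Qed.

Lemma root_bias_leaf (R : realType) (z : seq nat -> nat) :
  z [::] = 0%N -> root_bias R (gw_tree z) = 0.
Proof. by move=> z0; rewrite root_bias_gw_tree z0 eqxx mulr0. Qed.

Lemma children_mean_ge0 (R : realType) (z : seq nat -> nat) (k : nat) :
  0 <= children_mean R z k.
Proof. by rewrite mulr_ge0 ?invr_ge0 ?sumr_ge0. Qed.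

Lemma measurable_children_mean (d : measure_display) (T : measurableType d)
    (R : realType) (P : probability T R) (Z : seq nat -> {RV P >-> nat})
    (k : nat) (D : set T) : measurable D ->
  measurable_fun D (fun w => children_mean R (fun u => Z u w) k).
Proof.
move=> mD; apply: measurable_funM => //; apply: measurable_sum => j.
exact: measurable_comp_nat.
Qed.

Lemma integral_children_mean (d : measure_display) (T : measurableType d)
    (R : realType) (P : probability T R) (lam : R)
    (Z : seq nat -> {RV P >-> nat}) (k : nat) :
  0 < lam -> poisson_offspring lam Z ->
  (\int[P]_(w in Z [::] @^-1` [set k.+1])
      (children_mean R (fun u => Z u w) k.+1)%:E =
   (poisson_pmf lam k.+1 * lam)%:E)%E.
Proof.
move=> lam0 PZ.
have mD : measurable (Z [::] @^-1` [set k.+1]) by exact: measurable_funPTI.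
under eq_integral do rewrite EFinM -sumEFin.
rewrite ge0_integralZl_EFin//; last 2 first.
- by move=> w _; rewrite sumEFin lee_fin sumr_ge0.
- apply: emeasurable_sum => j; apply/measurable_EFinP.
  exact: measurable_comp_nat.
rewrite ge0_integral_sum//; last first.
  by move=> j; apply/measurable_EFinP; exact: measurable_comp_nat.
have intZ (j : nat) : (\int[P]_(w in Z [::] @^-1` [set k.+1]) (Z [:: j] w)%:R%:E =
    (poisson_pmf lam k.+1 * lam)%:E)%E.
  rewrite -[in RHS](expr1 lam).
  rewrite -(poisson_offspring_root_moment (s := [:: [:: j]]) k.+1 PZ
    (@ler0n R) (poisson_moment1 lam0))//.
  by apply: eq_integral => w _; rewrite big_seq1.
under eq_bigr do rewrite intZ.
rewrite sumEFin sumr_const card_ord -EFinM; congr EFin.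
by rewrite -[(_ * lam) *+ _]mulr_natl mulKf ?pnatr_eq0.
Qed.

(** The square expands into [k.+1 ^ 2] products of conditional mean [lam ^+ 2], with an excess [lam]
    on the [k.+1] diagonal ones; dividing by [k.+1 ^ 2] turns the excess into [lam / k.+1]. *)
Lemma integral_sqr_children_mean (d : measure_display) (T : measurableType d)
    (R : realType) (P : probability T R) (lam : R)
    (Z : seq nat -> {RV P >-> nat}) (k : nat) :
  0 < lam -> poisson_offspring lam Z ->
  (\int[P]_(w in Z [::] @^-1` [set k.+1])
      (children_mean R (fun u => Z u w) k.+1 ^+ 2)%:E =
   (poisson_pmf lam k.+1 * (lam ^+ 2 + lam / k.+1%:R))%:E)%E.
Proof.
move=> lam0 PZ.
have mD : measurable (Z [::] @^-1` [set k.+1]) by exact: measurable_funPTI.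
have mZ (j l : nat) : measurable_fun (Z [::] @^-1` [set k.+1])
    (fun w => ((Z [:: j] w)%:R * (Z [:: l] w)%:R : R)%:E).
  apply/measurable_EFinP; apply: measurable_funM; exact: measurable_comp_nat.
have Z0 (j l : nat) w : (0 <= ((Z [:: j] w)%:R * (Z [:: l] w)%:R : R)%:E)%E.
  by rewrite lee_fin mulr_ge0.
(* The diagonal case is the second moment [lam * (lam + 1)] at one vertex; otherwise two distinct
   vertices give a product of means. *)
have intZ (j l : nat) : (\int[P]_(w in Z [::] @^-1` [set k.+1])
      ((Z [:: j] w)%:R * (Z [:: l] w)%:R)%:E =
    (poisson_pmf lam k.+1 * (lam ^+ 2 + lam * (j == l)%:R))%:E)%E.
  have [<-|jl] := eqVneq j l.
    have := poisson_offspring_root_moment (s := [:: [:: j]]) k.+1 PZ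
      (fun n => sqr_ge0 (n%:R : R)) (poisson_moment2 lam0) isT.
    under eq_integral do rewrite big_seq1 expr2.
    by move=> ->; congr EFin; rewrite /=; ring.
  rewrite /= mulr0 addr0.
  rewrite -(poisson_offspring_root_moment (s := [:: [:: j]; [:: l]]) k.+1 PZ
    (@ler0n R) (poisson_moment1 lam0)); last first.
    by rewrite /= !inE /= andbT eqseq_cons eqxx andbT.
  by apply: eq_integral => w _; rewrite big_cons big_seq1.
under eq_integral.
  move=> w _; rewrite exprMn [X in _ * X]expr2 big_distrlr/= EFinM -sumEFin.
  under eq_bigr do rewrite -sumEFin.
  over.
have mS (j : nat) : measurable_fun (Z [::] @^-1` [set k.+1])
    (fun w => \sum_(l < k.+1) ((Z [:: j] w)%:R * (Z [:: nat_of_ord l] w)%:R : R)%:E)%E.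
  exact: emeasurable_sum.
have S0 (j : nat) w : (0 <= \sum_(l < k.+1)
    ((Z [:: j] w)%:R * (Z [:: nat_of_ord l] w)%:R : R)%:E)%E.
  exact: sume_ge0.
rewrite ge0_integralZl_EFin ?sqr_ge0//; last 2 first.
- by move=> w _; exact: sume_ge0.
- exact: emeasurable_sum.
rewrite ge0_integral_sum//.
under eq_bigr => j _.
  rewrite ge0_integral_sum//; under eq_bigr do rewrite intZ.
  rewrite sumEFin -mulr_sumr big_split/= sumr_const card_ord -mulr_sumr.
  rewrite (bigD1 j)//= eqxx big1 ?addr0 => [|l lj]; last first.
    by move: lj; rewrite -val_eqE eq_sym => /negbTE ->.
  over.
rewrite sumEFin sumr_const card_ord -EFinM; congr EFin.
have k0 : k.+1%:R != 0 :> R by rewrite pnatr_eq0.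
rewrite -[(_ * (_ + _)) *+ _]mulr_natl -[lam ^+ 2 *+ _]mulr_natl; move: k.+1%:R k0 => a a0.
by rewrite /=; field.
Qed.

(** * The bias on the fibres of the root degree *)

Lemma measurable_Delta (d : measure_display) (T : measurableType d)
    (R : realType) (P : probability T R) (Z : seq nat -> {RV P >-> nat}) :
  measurable_fun setT (Delta Z).
Proof.
apply: (measurable_fun_fibers (X := Z [::])) => -[|k].
  apply: (eq_measurable_fun (cst (0 : R))) => // w; rewrite inE /Delta => Dw.
  by rewrite root_bias_leaf.
apply: (eq_measurable_fun
    (fun w => children_mean R (fun u => Z u w) k.+1 - k%:R)) => [w|].
  by rewrite inE /Delta => Dw; rewrite (root_bias_children_mean R Dw).
by apply: measurable_funB => //; apply: measurable_children_mean; exact: measurable_funPTI.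
Qed.

Lemma poisson_offspring_fiber (d : measure_display) (T : measurableType d)
    (R : realType) (P : probability T R) (lam : R)
    (Z : seq nat -> {RV P >-> nat}) (k : nat) (c : R) :
  poisson_offspring lam Z ->
  (\int[P]_(w in Z [::] @^-1` [set k]) c%:E = (poisson_pmf lam k * c)%:E)%E.
Proof.
move=> [_ pmfZ]; rewrite mulrC EFinM -(pmfZ [::]).
by apply: integral_cst; exact: measurable_funPTI.
Qed.

(** The conditional variance [lam / k.+1] plus the squared conditional mean, where [lam - k] is
    written [lam + 1 - k.+1] to match [poisson_shifted_moment2]. *)
Lemma integral_sqr_Delta_fiber (d : measure_display) (T : measurableType d)
    (R : realType) (P : probability T R) (lam : R)
    (Z : seq nat -> {RV P >-> nat}) (k : nat) :
  0 < lam -> poisson_offspring lam Z ->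
  (\int[P]_(w in Z [::] @^-1` [set k.+1]) (Delta Z w ^+ 2)%:E =
   (lam * (k.+1%:R^-1 * poisson_pmf lam k.+1))%:E +
   ((lam + 1 - k.+1%:R) ^+ 2 * poisson_pmf lam k.+1)%:E)%E.
Proof.
move=> lam0 PZ.
set D := Z [::] @^-1` [set k.+1].
have mD : measurable D by exact: measurable_funPTI.
pose M w : R := children_mean R (fun u => Z u w) k.+1.
have mM : measurable_fun D M by exact: measurable_children_mean.
have M0 w : 0 <= M w by exact: children_mean_ge0.
have mDelta : measurable_fun D (fun w => (Delta Z w ^+ 2)%:E).
  apply/measurable_EFinP; apply: measurable_funX.
  exact: measurable_funS (measurable_Delta Z).
(* Delta^2 + 2 k M = M^2 + k^2 has only nonnegative terms, so additivity needs no
   integrability. *)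
have : (\int[P]_(w in D) (Delta Z w ^+ 2)%:E +
    \int[P]_(w in D) ((2 * k%:R)%:E * (M w)%:E) =
    \int[P]_(w in D) (M w ^+ 2)%:E + \int[P]_(w in D) (k%:R ^+ 2)%:E)%E.
  rewrite -!ge0_integralD//; last 5 first.
  - by move=> w _; rewrite lee_fin sqr_ge0.
  - by apply/measurable_EFinP; exact: measurable_funX.
  - by move=> w _; rewrite lee_fin sqr_ge0.
  - by move=> w _; rewrite -EFinM lee_fin mulr_ge0// mulr_ge0.
  - by apply/measurable_EFinP; exact: measurable_funM.
  apply: eq_integral => w; rewrite inE => Dw.
  rewrite -EFinM -!EFinD; congr EFin.
  by rewrite /Delta (root_bias_children_mean R Dw) -/(M w); ring.
rewrite ge0_integralZl_EFin//; last 2 first.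
- by move=> w _; rewrite lee_fin.
- exact/measurable_EFinP.
rewrite (integral_children_mean k lam0 PZ) (integral_sqr_children_mean k lam0 PZ).
rewrite (poisson_offspring_fiber _ _ PZ) -EFinM -EFinD.
move=> /eqP; rewrite eq_sym -sube_eq ?fin_num_adde_defl// => /eqP <-.
rewrite -EFinB -EFinD; congr EFin.
rewrite -natr1; have := ltr0Sn R k; rewrite -natr1 => k0.
by field; rewrite gt_eqF.
Qed.

(** * The two expectations *)

Lemma Delta_leaf (d : measure_display) (T : measurableType d) (R : realType)
    (P : probability T R) (Z : seq nat -> {RV P >-> nat}) (w : T) :
  w \in Z [::] @^-1` [set 0%N] -> Delta Z w = 0.
Proof. by rewrite inE => Dw; rewrite /Delta root_bias_leaf. Qed.

Lemma poisson_pmf0 (R : realType) (lam : R) : 0 < lam ->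
  poisson_pmf lam 0 = expR (- lam).
Proof. by move=> lam0; rewrite poisson_pmfE// expr0 mulr1 fact0 divr1. Qed.

Lemma nneseriesS (R : realType) (f : nat -> \bar R) : (forall k, 0 <= f k)%E ->
  (\sum_(k <oo) f k = f 0%N + \sum_(k <oo) f k.+1)%E.
Proof.
move=> f0; rewrite nneseries_recl// -nneseries_addn//.
by under eq_eseriesr do rewrite addn1.
Qed.

(** [Delta] takes both signs, so the root degree is added to it: the sum is 0 when the root has no
    children and the children mean plus 1 otherwise. This is nonnegative and can be integrated fibre
    by fibre; the mean [lam] of the degree is then subtracted. *)
Lemma expectation_Delta (d : measure_display) (T : measurableType d)
    (R : realType) (P : probability T R) (lam : R)
    (Z : seq nat -> {RV P >-> nat}) :
  0 < lam -> poisson_offspring lam Z ->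
  ('E_P[Delta Z] = (1 - (lam + 1) * expR (- lam))%:E)%E.
Proof.
move=> lam0 PZ; have pmf0 := @poisson_pmf_ge0 R lam.
pose W w : R := Delta Z w + (Z [::] w)%:R.
have WS k w : w \in Z [::] @^-1` [set k.+1] ->
    W w = children_mean R (fun u => Z u w) k.+1 + 1.
  rewrite inE => Dw; rewrite /W /Delta (root_bias_children_mean R Dw) Dw.
  by rewrite -natr1; ring.
have W0 w : 0 <= W w.
  case Zw : (Z [::] w) => [|k].
    by rewrite /W Zw addr0 Delta_leaf// inE.
  by rewrite (WS k) ?inE// addr_ge0 ?children_mean_ge0.
have mZ : measurable_fun setT (fun w => (Z [::] w)%:R : R).
  exact: measurable_comp_nat.
have mW : measurable_fun setT W by exact: measurable_funD (measurable_Delta Z) mZ.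
have intZ : (\int[P]_w (Z [::] w)%:R%:E = lam%:E)%E.
  rewrite (ge0_integral_fibers (Z [::]))//; last first.
    exact/measurable_EFinP.
  rewrite -(poisson_moment1 lam0); apply: eq_eseriesr => k _; rewrite setTI.
  rewrite mulrC -(poisson_offspring_fiber k _ PZ).
  by apply: eq_integral => w; rewrite inE => ->.
have intW : (\int[P]_w (W w)%:E = ((lam + 1) * (1 - expR (- lam)))%:E)%E.
  rewrite (ge0_integral_fibers (Z [::]))//; last 2 first.
  - exact/measurable_EFinP.
  - by move=> w _; rewrite lee_fin.
  under eq_eseriesr do rewrite setTI.
  rewrite nneseriesS => [|k]; last first.
    by apply: integral_ge0 => w _; rewrite lee_fin.
  rewrite integral0_eq ?add0e => [|w Dw]; last first.
    by rewrite /W Delta_leaf ?inE// Dw addr0.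
  (* The fibre of degree [k.+1] contributes [(lam + 1) * poisson_pmf lam k.+1], and the masses from
     index 1 on add up to [1 - expR (- lam)]. *)
  transitivity ((lam + 1)%:E * \sum_(k <oo) (poisson_pmf lam k.+1)%:E)%E; last first.
    have := poisson_sum lam0; rewrite nneseriesS => [|k]; last by rewrite lee_fin.
    move=> /eqP; rewrite addeC eq_sym -sube_eq ?fin_num_adde_defl// => /eqP <-.
    by rewrite poisson_pmf0.
  rewrite -nneseriesZl => [|k _]; last by rewrite lee_fin.
  apply: eq_eseriesr => k _.
  have mD : measurable (Z [::] @^-1` [set k.+1]) by exact: measurable_funPTI.
  under eq_integral => w Dw do rewrite (WS k w Dw) EFinD.
  rewrite ge0_integralD//; last 2 first.
  - by move=> w _; rewrite lee_fin children_mean_ge0.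
  - by apply/measurable_EFinP; exact: measurable_children_mean.
  rewrite (integral_children_mean k lam0 PZ) (poisson_offspring_fiber _ _ PZ).
  by rewrite -EFinD -EFinM; congr EFin; ring.
have integrableW : P.-integrable setT (EFin \o W).
  apply/integrableP; split; first exact/measurable_EFinP.
  by under eq_integral do rewrite /= ger0_norm//; rewrite intW ltry.
have integrableZ : P.-integrable setT (EFin \o (fun w => (Z [::] w)%:R : R)).
  apply/integrableP; split; first exact/measurable_EFinP.
  by under eq_integral do rewrite /= ger0_norm//; rewrite intZ ltry.
rewrite unlock; transitivity
  (\int[P]_w ((EFin \o W) \- (EFin \o (fun w => (Z [::] w)%:R : R))) w)%E.
  by apply: eq_integral => w _; rewrite /= /W -EFinB addrK.
rewrite integralB// intW intZ -EFinB; congr EFin; ring.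
Qed.

(** The conditional variances sum to [lam] times the inverse moment, the squared conditional means
    to [lam + 1] less the missing term at degree 0. The series is kept in the extended reals;
    [poisson_inv_moment] shows that it is finite. *)
Lemma expectation_sqr_Delta (d : measure_display) (T : measurableType d)
    (R : realType) (P : probability T R) (lam : R)
    (Z : seq nat -> {RV P >-> nat}) :
  0 < lam -> poisson_offspring lam Z ->
  ('E_P[fun w => (Delta Z w ^+ 2)%R] =
   lam%:E * (\sum_(1 <= k <oo)
               (k%:R^-1 * (expR (- lam) * lam ^+ k / k`!%:R))%:E + 1)
   - ((lam + 1) ^+ 2 * expR (- lam))%:E + 1)%E.
Proof.
move=> lam0 PZ; have pmf0 := @poisson_pmf_ge0 R lam.
under eq_eseriesr do rewrite -poisson_pmfE//.
(* The inverse of 0 is 0, so this covers [k = 0] too, as the index shift by [nneseries_addn] below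
   requires. *)
have p0 k : (0 <= (k%:R^-1 * poisson_pmf lam k)%:E)%E.
  by rewrite lee_fin mulr_ge0 ?invr_ge0.
have q0 k : (0 <= ((lam + 1 - k%:R) ^+ 2 * poisson_pmf lam k)%:E)%E.
  by rewrite lee_fin mulr_ge0 ?sqr_ge0.
rewrite unlock (ge0_integral_fibers (Z [::]))//; last 2 first.
- apply/measurable_EFinP; apply: measurable_funX; exact: measurable_Delta.
- by move=> w _; rewrite lee_fin sqr_ge0.
under [in LHS]eq_eseriesr do rewrite setTI.
rewrite nneseriesS => [|k]; last first.
  by apply: integral_ge0 => w _; rewrite lee_fin sqr_ge0.
rewrite integral0_eq ?add0e => [|w Dw]; last by rewrite Delta_leaf ?inE ?expr0n.
under [in LHS]eq_eseriesr do rewrite (integral_sqr_Delta_fiber _ lam0 PZ) EFinM.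
rewrite nneseriesD => [|k _ _|k _ _]; last 2 first.
- by rewrite mule_ge0// lee_fin ltW.
- exact: q0.
rewrite nneseriesZl; last by move=> k _; exact: p0.
(* The series from index 1 is [lam + 1] minus the term [(lam + 1) ^+ 2 * expR (- lam)] of index
   0. *)
have := poisson_shifted_moment2 lam0; rewrite (nneseriesS q0).
move=> /eqP; rewrite addeC eq_sym -sube_eq ?fin_num_adde_defl// => /eqP <-.
rewrite poisson_pmf0// subr0 -(@nneseries_addn _ _ 1 p0).
under [in RHS]eq_eseriesr do rewrite addn1.
rewrite ge0_muleDr//; last by apply: nneseries_ge0 => k _ _; exact: p0.
rewrite mule1 -!addeA; congr (_ + _)%E.
by rewrite -EFinB -!EFinD; congr EFin; ring.
Qed.

(** * Bounds that yield the limits *)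

(** The inverse of [k >= 1] is at most 1, so the total Poisson mass dominates. The real witness
    turns the later bounds into real inequalities. *)
Lemma poisson_inv_moment (R : realType) (lam : R) : 0 < lam ->
  exists2 s : R, 0 <= s <= 1 &
    (\sum_(1 <= k <oo) (k%:R^-1 * (expR (- lam) * lam ^+ k / k`!%:R))%:E = s%:E)%E.
Proof.
move=> lam0; have pmf0 := @poisson_pmf_ge0 R lam.
pose S := (\sum_(1 <= k <oo) (k%:R^-1 * poisson_pmf lam k)%:E)%E.
have S0 : (0 <= S)%E.
  by apply: nneseries_ge0 => k _ _; rewrite lee_fin mulr_ge0 ?invr_ge0.
have S1 : (S <= 1)%E.
  rewrite -(poisson_sum lam0) /S -[leLHS](@nneseries_addn _ _ 1); last first.
    by move=> k; rewrite lee_fin mulr_ge0 ?invr_ge0.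
  rewrite [leRHS]nneseriesS => [|k]; last by rewrite lee_fin.
  rewrite -[leLHS]add0e; apply: leeD; first by rewrite lee_fin.
  apply: lee_nneseries => k _; first by rewrite lee_fin mulr_ge0 ?invr_ge0.
  by rewrite addn1 lee_fin ler_piMl// invf_le1 ?ltr0Sn// ler1n.
have Sfin : S \is a fin_num by rewrite ge0_fin_numE// (le_lt_trans S1) ?ltry.
exists (fine S); last first.
  rewrite fineK// /S.
  by apply: eq_eseriesr => k _; rewrite poisson_pmfE.
by rewrite -!lee_fin fineK// S0 S1.
Qed.

(** Squaring [1 + x / 2 <= expR (x / 2)] gives [(x + 2) ^+ 2 <= 4 * expR x]. *)
Lemma sqr_expRN_le4 (R : realType) (x : R) : 0 <= x ->
  (x + 1) ^+ 2 * expR (- x) <= 4.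
Proof.
move=> x0; rewrite expRN ler_pdivrMr ?expR_gt0//.
have -> : x = x / 2 + x / 2 by lra.
rewrite expRD; have := expR_ge1Dx (x / 2); move: (expR _) => e e1.
rewrite -splitr; nra.
Qed.

(** Below, [1 + lam <= expR lam]; above, [(lam + 1) * expR (- lam) >= expR (- lam) >= 1 - lam]. *)
Lemma expectation_Delta_le (d : measure_display) (T : measurableType d)
    (R : realType) (P : probability T R) (lam : R)
    (Z : seq nat -> {RV P >-> nat}) :
  0 < lam -> poisson_offspring lam Z -> (0 <= 'E_P[Delta Z] <= lam%:E)%E.
Proof.
move=> lam0 PZ; rewrite (expectation_Delta lam0 PZ) !lee_fin subr_ge0.
have eN := expR_ge1Dx (- lam); have eN0 := expR_gt0 (- lam).
apply/andP; split; last by nra.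
by rewrite expRN ler_pdivrMr ?expR_gt0// mul1r addrC expR_ge1Dx.
Qed.

(** The inverse moment is at most 1, which accounts for [2 * lam]; the other terms are at most
    [1 - expR (- lam) <= lam]. *)
Lemma expectation_sqr_Delta_le (d : measure_display) (T : measurableType d)
    (R : realType) (P : probability T R) (lam : R)
    (Z : seq nat -> {RV P >-> nat}) :
  0 < lam -> poisson_offspring lam Z ->
  (0 <= 'E_P[fun w => (Delta Z w ^+ 2)%R] <= (3 * lam)%:E)%E.
Proof.
move=> lam0 PZ; apply/andP; split.
  by apply: expectation_ge0 => w; exact: sqr_ge0.
rewrite (expectation_sqr_Delta lam0 PZ).
have [s /andP[s0 s1] ->] := poisson_inv_moment lam0.
rewrite -[(s%:E + 1)%E]EFinD -EFinM -EFinB -EFinD lee_fin.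
have eN := expR_ge1Dx (- lam); have eN0 := expR_gt0 (- lam).
have : expR (- lam) <= (lam + 1) ^+ 2 * expR (- lam) by rewrite ler_peMl ?ltW//; nra.
nra.
Qed.

(** The inverse moment is dropped, and [sqr_expRN_le4] bounds the other terms below by [1 - 4]. *)
Lemma expectation_sqr_Delta_ge (d : measure_display) (T : measurableType d)
    (R : realType) (P : probability T R) (lam : R)
    (Z : seq nat -> {RV P >-> nat}) :
  0 < lam -> poisson_offspring lam Z ->
  ((lam - 3)%:E <= 'E_P[fun w => (Delta Z w ^+ 2)%R])%E.
Proof.
move=> lam0 PZ; rewrite (expectation_sqr_Delta lam0 PZ).
have [s /andP[s0 s1] ->] := poisson_inv_moment lam0.
rewrite -[(s%:E + 1)%E]EFinD -EFinM -EFinB -EFinD lee_fin.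
have := sqr_expRN_le4 (ltW lam0); nra.
Qed.

Theorem theorem4p2 (R : realType) :
  (forall (d : measure_display) (T : measurableType d) (P : probability T R)
      (lam : R) (Z : seq nat -> {RV P >-> nat}),
    0 < lam -> poisson_offspring lam Z ->
    ('E_P[Delta Z] = (1 - (lam + 1) * expR (- lam))%:E)%E /\
    ('E_P[fun w => (Delta Z w ^+ 2)%R] =
      lam%:E * (\sum_(1 <= k <oo)
                  (k%:R^-1 * (expR (- lam) * lam ^+ k / k`!%:R))%:E + 1)
      - ((lam + 1) ^+ 2 * expR (- lam))%:E + 1)%E)
  /\
  (forall (d : R -> measure_display) (T : forall lam : R, measurableType (d lam))
      (P : forall lam : R, probability (T lam) R)
      (Z : forall lam : R, seq nat -> {RV (P lam) >-> nat}),
    (forall lam : R, 0 < lam -> poisson_offspring lam (Z lam)) ->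
    [/\ 'E_(P lam)[Delta (Z lam)]%E @[lam --> 0^'+] --> 0%E,
        'E_(P lam)[fun w => (Delta (Z lam) w ^+ 2)%R]%E @[lam --> 0^'+] --> 0%E,
        'E_(P lam)[Delta (Z lam)]%E @[lam --> +oo] --> 1%E
      & 'E_(P lam)[fun w => (Delta (Z lam) w ^+ 2)%R]%E @[lam --> +oo] --> +oo%E]).
Proof.
split=> [d T P lam Z lam0 PZ|d T P Z PZ].
  by split; [exact: expectation_Delta|exact: expectation_sqr_Delta].
(* The linear bounds with [c = 1] and [c = 3] squeeze both expectations at 0. *)
have cvgM0 (c : R) : (c * lam)%:E @[lam --> 0^'+] --> 0%E.
  apply: cvg_EFin; first exact: nearW.
  apply: cvg_at_right_filter; rewrite -[X in _ --> X](mulr0 c).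
  exact: cvgMr.
split.
- apply: (@squeeze_cvge _ _ _ _ (cst 0%E) _ (fun lam => (1 * lam)%:E)).
  + near=> lam; rewrite mul1r; apply: expectation_Delta_le => //.
    exact: PZ.
  + exact: cvg_cst.
  + exact: cvgM0.
- apply: (@squeeze_cvge _ _ _ _ (cst 0%E) _ (fun lam => (3 * lam)%:E)).
  + near=> lam; apply: expectation_sqr_Delta_le => //.
    exact: PZ.
  + exact: cvg_cst.
  + exact: cvgM0.
- apply: (cvg_trans (G := (1 - (lam + 1) * expR (- lam))%:E @[lam --> +oo])).
    apply: near_eq_cvg; near=> lam; rewrite (expectation_Delta _ (PZ lam _))//.
  apply: cvg_EFin; first exact: nearW.
  apply/cvgrPdist_le => e e0; near=> lam.
  have lam0 : 0 < lam by near: lam; apply: nbhs_pinfty_gt; exact: num_real.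
  (* By [sqr_expRN_le4], [(lam + 1) * expR (- lam) <= 4 / (lam + 1)], which is then below [e]. *)
  have : 4 / e < lam by near: lam; apply: nbhs_pinfty_gt; exact: num_real.
  rewrite /= opprB addrC subrK ger0_norm; last first.
    by rewrite mulr_ge0 ?expR_ge0//; lra.
  have := sqr_expRN_le4 (ltW lam0); have := expR_gt0 (- lam).
  rewrite ltr_pdivrMr//; nra.
- apply/cvgeyPge => A; near=> lam.
  apply: le_trans (expectation_sqr_Delta_ge _ (PZ lam _)) => //.
  by rewrite lee_fin lerBrDr.
Unshelve. all: by end_near. Qed.
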